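(* Let $S$ be a countable set and let $P=(p_{x,y})_{x,y\in S}$ be an irreducible, aperiodic, and positive recurrent transition matrix on $S$. Let $(X_t)_{t\in\mathbb Z}$ be a Markov chain, indexed by all of $\mathbb Z$, with transition matrix $P$. Then the following are equivalent: (a) $(X_t)_{t\in\mathbb Z}$ is stationary; (b) $(X_t)_{t\in\mathbb Z}$ is bi-recurrent for some state $x\in S$; (c) $(X_t)_{t\in\mathbb Z}$ is bi-recurrent for every state $x\in S$.
   Context: $(X_t)_{t\in\mathbb Z}$ is a Markov chain with transition matrix $P$ if $\mathbb P(X_{t+1}=y\mid (X_s)_{s\le t})=p_{X_t,y}$ for all $t\in\mathbb Z$, $y\in S$ (no assumption on the marginal laws). The process is bi-recurrent for $x$ if almost surely the set $\{t\in\mathbb Z:X_t=x\}$ is unbounded above and unbounded below. *)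

(* Defs.v *)
From HB Require Import structures.
From mathcomp Require Import all_boot all_order all_algebra.
From mathcomp Require Import all_classical all_reals all_analysis.

Set Implicit Arguments.
Unset Strict Implicit.
Unset Printing Implicit Defensive.
Import Order.TTheory GRing.Theory Num.Theory.

Local Open Scope classical_set_scope.
Local Open Scope ring_scope.

Section TransitionMatrix.
Context {R : realType} {S : countType}.
Implicit Type p : S -> S -> R.

Definition transition_matrix p : Prop :=
  (forall x y, 0 <= p x y) /\
  (forall x, \esum_(y in [set: S]) (p x y)%:E = 1%E).

(* The entry (x, y) of the n-th power of p. *)
Fixpoint trans_pow p (n : nat) (x y : S) : \bar R :=
  if n is m.+1
  then (\esum_(z in [set: S]) ((p x z)%:E * trans_pow p m z y))%E
  else (x == y)%:R%:E.

(* The probability that the chain started at x visits y for the first time,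
   not counting time 0, at time n. *)
Fixpoint first_passage p (n : nat) (x y : S) : \bar R :=
  match n with
  | 0%N => 0%E
  | m.+1 =>
      if m is 0%N then (p x y)%:E
      else (\esum_(z in [set z | z != y])
              ((p x z)%:E * first_passage p m z y))%E
  end.

Definition irreducible_matrix p : Prop :=
  forall x y, exists n : nat, (0 < trans_pow p n x y)%E.

(* The return times {n >= 1 | p^n(x, x) > 0} have greatest common divisor 1. *)
Definition aperiodic_matrix p : Prop :=
  forall x (k : nat),
    (forall n : nat, (0 < n)%N -> (0 < trans_pow p n x x)%E -> (k %| n)%N) ->
    k = 1%N.

(* The return time to x is almost surely finite and has finite mean. *)
Definition positive_recurrent_matrix p : Prop :=
  forall x,
    (\sum_(1 <= n <oo) first_passage p n x x = 1)%E /\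
    (\sum_(1 <= n <oo) (n%:R%:E * first_passage p n x x) < +oo)%E.

End TransitionMatrix.

(* f is a version of the conditional probability of E given the
   sub-sigma-algebra G. *)
Definition is_cond_prob d (T : measurableType d) (R : realType)
    (P : probability T R) (G : set (set T)) (E : set T) (f : T -> R) : Prop :=
  [/\ forall B : set R, measurable B -> G (f @^-1` B),
      P.-integrable [set: T] (EFin \o f) &
      forall A, G A -> (\int[P]_(w in A) (f w)%:E = P (A `&` E))%E].

Section Process.
Context d {T : measurableType d} {R : realType} {S : countType}.
Variable P : probability T R.
Implicit Type X : int -> T -> S.

(* S carries the discrete sigma-algebra. *)
Definition process X : Prop :=
  forall t (B : set S), measurable (X t @^-1` B).

(* The sigma-algebra generated by (X_s)_{s <= t}. *)
Definition past X (t : int) : set (set T) :=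
  <<s [set X s @^-1` B | s in [set s : int | s <= t] & B in [set: set S]] >>.

Definition markov_chain (p : S -> S -> R) X : Prop :=
  process X /\
  forall (t : int) (y : S),
    is_cond_prob P (past X t) (X (t + 1) @^-1` [set y])
      (fun w => p (X t w) y).

(* The product sigma-algebra on S^Z. *)
Definition path_measurable : set (set (int -> S)) :=
  <<s [set [set u | B (u t)] | t in [set: int] & B in [set: set S]] >>.

(* All time shifts of the process have the same law on S^Z. *)
Definition stationary X : Prop :=
  forall (h : int) (B : set (int -> S)), path_measurable B ->
    P [set w | B (fun t => X (t + h) w)] = P [set w | B (fun t => X t w)].

Definition bi_recurrent X (x : S) : Prop :=
  {ae P, forall w,
    (forall n : int, exists2 t : int, n <= t & X t w = x) /\
    (forall n : int, exists2 t : int, t <= n & X t w = x)}.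

End Process.

(* Main.v *)
(* If the chain is stationary, recurrence makes it return to [x] after any given
   time, and the probability of avoiding [x] on a window of length [m] does not
   depend on the position of the window, so it also visits [x] before any given
   time.

   Conversely, if the chain is bi-recurrent for [x], decompose at its first
   visit [s] to [x] after time [-N], where [s] tends to minus infinity with [N].
   Given [s], the probability of [X_t = y] is [p^(t - s)(x, y)], which converges
   as [t - s] grows by the renewal theorem; so the law of [X_t] is the limit and
   does not depend on [t]. By the Markov property the laws of all finite windows
   are then shift invariant. *)
Require Import Defs.
From HB Require Import structures.
From mathcomp Require Import all_boot all_order all_algebra.
From mathcomp Require Import all_classical all_reals all_analysis.
From mathcomp Require Import zify ring lra.

Set Implicit Arguments.
Unset Strict Implicit.
Unset Printing Implicit Defensive.
Import Order.TTheory GRing.Theory Num.Theory.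
Import numFieldNormedType.Exports.

Local Open Scope classical_set_scope.
Local Open Scope ring_scope.

(** * The renewal theorem *)

(* With [d] the least positive difference of two elements [a], [a + d], every
   [n] in [D] is a multiple of [d]: otherwise a multiple of [a + d] exceeds
   some element by [d - n %% d < d]. *)
Lemma addn_closed_cofinite (D : nat -> Prop) :
  D 0%N -> (forall a b, D a -> D b -> D (a + b)%N) ->
  (forall k, (forall n, (0 < n)%N -> D n -> (k %| n)%N) -> k = 1%N) ->
  exists N, forall n, (N <= n)%N -> D n.
Proof.
move=> D0 DD D1.
have DM a q : D a -> D (a * q)%N.
  by move=> Da; elim: q => [|q IH]; rewrite ?muln0// mulnS; exact: DD.
pose Q d := `[< (0 < d)%N /\ exists a, D a /\ D (a + d)%N >].
have exQ : exists d, Q d.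
  have [[n n0 Dn]|noD] := pselect (exists2 n, (0 < n)%N & D n).
    by exists n; apply/asboolP; split => //; exists 0%N.
  suff : 2%N = 1%N by [].
  by apply: D1 => n n0 Dn; exfalso; apply: noD; exists n.
case: (ex_minnP exQ) => d /asboolP[d0 [a [Da Dad]]] dmin.
have {dmin} d1 : d = 1%N.
  apply: D1 => n n0 Dn; rewrite /dvdn; apply/negPn/negP => r0.
  have := dmin (d - n %% d)%N.
  have lt_r : (n %% d < d)%N by rewrite ltn_mod.
  have /[swap] /[apply] : Q (d - n %% d)%N.
    apply/asboolP; split; first by lia.
    exists (n + a * (n %/ d).+1)%N; split; first by apply: DD => //; exact: DM.
    suff -> : (n + a * (n %/ d).+1 + (d - n %% d) = (a + d) * (n %/ d).+1)%N.
      exact: DM.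
    have := divn_eq n d; set q := (n %/ d)%N; set r := (n %% d)%N in lt_r *.
    move=> ->; nia.
  by lia.
rewrite {}d1 addn1 in Dad.
exists (a * a)%N => n an.
have [a0|a0] := posnP a.
  by rewrite -[n]mul1n; apply: DM; rewrite a0 in Dad.
rewrite (divn_eq n a).
have r_q : (n %% a <= n %/ a)%N.
  by rewrite (@leq_trans a)// ?leq_divRL// ltnW// ltn_mod.
have -> : (n %/ a * a + n %% a = a * (n %/ a - n %% a) + a.+1 * (n %% a))%N.
  move: r_q; set q := (n %/ a)%N; set r := (n %% a)%N; nia.
by apply: DD; exact: DM.
Qed.

Section renewal.
Context {R : realType}.
Implicit Types (g v : R^nat).

(** The number [l] is the limit superior, obtained as the supremum of the levels that [v] reaches at
    arbitrarily large indices. *)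
Lemma bounded_limsup v : (forall n, `|v n| <= 1) ->
  exists l : R, [/\ l <= 1,
    forall e, 0 < e -> forall N, exists2 n, (N <= n)%N & l - e <= v n &
    forall e, 0 < e -> exists N, forall n, (N <= n)%N -> v n <= l + e].
Proof.
move=> v1; pose A := [set a | forall N, exists2 n, (N <= n)%N & a <= v n].
have A1 : ubound A 1.
  by move=> a /(_ 0%N)[n _ /le_trans]; apply; exact: le_trans (ler_norm _) _.
have hA : has_sup A.
  split; last by exists 1.
  exists (-1) => N; exists N => //.
  by have := v1 N; rewrite ler_norml => /andP[].
exists (sup A); split.
- by apply: ge_sup => //; case: hA.
- move=> e e0 N; have [a Aa lea] := sup_adherent e0 hA.
  by have [n Nn an] := Aa N; exists n => //; exact: le_trans (ltW lea) an.
- move=> e e0; apply: contrapT => noN.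
  suff : A (sup A + e) by move/(sup_upper_bound hA); lra.
  move=> N; apply: contrapT => no; apply: noN; exists N => n Nn.
  by rewrite leNgt; apply/negP => lt; apply: no; exists n => //; exact: ltW.
Qed.

Section upper.
(** In the application [g k] is the probability that the first return takes [k.+1] steps, and [m],
    the sum of the tails of [g], is the mean return time. The bound on [v] is on its absolute value,
    so that the section applies to a sequence and to its negative. *)
Variables (g v : R^nat) (m : R).
Hypothesis g0 : forall k, 0 <= g k.
Hypothesis g1 : series g @ \oo --> (1 : R).
Hypothesis gm : series (fun j => 1 - series g j) @ \oo --> m.
Hypothesis ggcd : forall k, (forall j, 0 < g j -> (k %| j.+1)%N) -> k = 1%N.
Hypothesis v1 : forall n, `|v n| <= 1.
Hypothesis vrec :
  forall n, v n.+1 = \sum_(0 <= k < n.+1) g k * v (n - k)%N.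

Let s_nd : nondecreasing_seq (series g).
Proof.
by apply/nondecreasing_seqP => n; rewrite seriesSr lerDl.
Qed.

Let s1 n : series g n <= 1.
Proof.
rewrite -(cvg_lim (@Rhausdorff R) g1); apply: nondecreasing_cvgn_le => //.
by apply/cvg_ex; exists 1.
Qed.

Let rs_nd : nondecreasing_seq (series (fun j => 1 - series g j)).
Proof.
by apply/nondecreasing_seqP => n; rewrite seriesSr lerDl subr_ge0.
Qed.

Let rsm n : series (fun j => 1 - series g j) n <= m.
Proof.
rewrite -(cvg_lim (@Rhausdorff R) gm); apply: nondecreasing_cvgn_le => //.
by apply/cvg_ex; exists m.
Qed.

Let m1 : 1 <= m.
Proof.
by have := rsm 1; rewrite seriesEnat /= big_nat1 seriesEnat /= big_geq// subr0.
Qed.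

Let vle n : v n <= 1. Proof. exact: le_trans (ler_norm _) (v1 n). Qed.
Let vge n : -1 <= v n.
Proof. by have := v1 n; rewrite ler_norml => /andP[]. Qed.

(** Passing from [n] to [n.+1] adds the term [v n.+1] and lowers the weight of [v (n - j)] by [g j];
    by the recursion the two changes cancel. *)
Let renewal_sum n :
  \sum_(0 <= j < n.+1) (1 - series g j) * v (n - j)%N = v 0%N.
Proof.
elim: n => [|n IH].
  by rewrite big_nat1 seriesEnat/= big_geq// subr0 mul1r.
rewrite big_nat_recl//= {1}seriesEnat/= big_geq// subr0 mul1r subn0 vrec.
rewrite -[RHS]IH -big_split; apply: eq_bigr => j _ /=.
by rewrite subSS seriesSr; ring.
Qed.

(* If [n] is a large index with [v n] close to the limsup [l], the recursion
   forces [v (n - j)] to be close to [l] for every [j] in the semigroup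
   generated by the support of [g] shifted by one, hence for all large [j];
   inserting this into [renewal_sum] bounds [l * m]. *)
Lemma renewal_upper e : 0 < e ->
  exists N, forall n, (N <= n)%N -> v n * m <= v 0%N + e.
Proof.
move=> e0; have [l [l1 lfreq lev]] := bounded_limsup v1.
(* [D j] says that being almost as large as [l] passes from a late index [n] back to [n - j]. *)
pose D j := forall e, 0 < e -> exists2 d, 0 < d &
  exists N, forall n, (N <= n)%N -> l - d <= v n -> l - e <= v (n - j)%N.
have D0 : D 0%N.
  by move=> t t0; exists t => //; exists 0%N => n _; rewrite subn0.
have DD a b : D a -> D b -> D (a + b)%N.
  move=> Da Db t t0.
  have [d d0 [N HN]] := Da _ t0; have [d' d'0 [N' HN']] := Db _ d0.
  exists d' => //; exists (N' + N + b)%N => n Nn vn.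
  by rewrite addnC subnDA; apply: HN; [lia|apply: HN' => //; lia].
have Dg j : 0 < g j -> D j.+1.
  (* Isolate the term [g j * v (n - j)] of the recursion: the other terms below [K] are at most
     [g k * (l + h)], and those from [K] on add at most [h]. The factor 4 absorbs these errors, the
     gap between [v n.+1] and [l], and the missing mass of [g] beyond [K]. *)
  move=> gj0 t t0; pose h := t * g j / 4.
  have h0 : 0 < h by rewrite divr_gt0// mulr_gt0.
  have hE : h * 4 = t * g j by rewrite /h divfK.
  clearbody h.
  have [N0 HN0] := lev h h0.
  have [K0 HK0] : exists K, forall k, (K <= k)%N -> 1 - series g k <= h.
    move/cvgrPdist_le : g1 => /(_ _ h0)[K _ HK]; exists K => k /HK.
    exact: le_trans (ler_norm _).
  exists h => //; exists (N0 + (K0 + j.+1)).+1 => -[//|n] Nn vn.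
  pose K := (K0 + j.+1)%N.
  have hK : 1 - series g K <= h by apply: HK0; rewrite leq_addr.
  have lh : -1 <= l + h by exact: le_trans (vge N0) (HN0 _ (leqnn _)).
  have Kn : (K <= n.+1)%N by rewrite /K; lia.
  have : v n.+1 <= g j * v (n - j)%N + (series g K - g j) * (l + h) + h.
    rewrite vrec (@big_cat_nat _ _ _ K)//=; apply: lerD.
      have jK : (j < K)%N by rewrite /K; lia.
      rewrite seriesEnat/= !big_mkord (bigD1 (Ordinal jK))//= lerD2l.
      rewrite [in leRHS](bigD1 (Ordinal jK))//= addrAC subrr add0r mulr_suml.
      apply: ler_sum => k _; apply: ler_wpM2l => //; apply: HN0.
      by have := ltn_ord k; rewrite /K; lia.
    apply: (@le_trans _ _ (\sum_(K <= k < n.+1) g k)).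
      by apply: ler_sum => k _; rewrite ler_piMr.
    have := s1 n.+1; rewrite seriesEnat/= (@big_cat_nat _ _ _ K)//=.
    by move: hK; rewrite seriesEnat/=; lra.
  rewrite subSS => vn'.
  rewrite -(ler_pM2l gj0).
  have := s1 K; nra.
have [J HJ] : exists J, forall j, (J <= j)%N -> D j.
  apply: addn_closed_cofinite => // k kD; apply: ggcd => j gj.
  by apply: kD => //; exact: Dg.
(* Choose [n] late with [v n] near [l]. Then [v] is at least [l - h] at the [K] indices going down
   from [n - J], and [renewal_sum] at [n - J] compares their weighted sum with [v 0]; the weights
   beyond [K] add up to at most [h]. *)
have lm h : 0 < h -> l * m - h * m - 2 * h <= v 0%N.
  move=> h0.
  have [K HK] : exists K, m - series (fun j => 1 - series g j) K <= h.
    move/cvgrPdist_le : gm => /(_ _ h0)[K _ HK]; exists K.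
    by apply: le_trans (ler_norm _) _; apply: HK => /=.
  (* One threshold serves all [K] lags, by induction on their number and taking minima. *)
  have [d d0 [N HN]] : exists2 d, 0 < d & exists N, forall n, (N <= n)%N ->
      l - d <= v n -> forall j, (j < K)%N -> l - h <= v (n - (J + j))%N.
    move: (K); elim=> [|K' [d d0 [N HN]]]; first by exists 1 => //; exists 0%N.
    have [d' d'0 [N' HN']] := HJ (J + K')%N (leq_addr _ _) _ h0.
    exists (Num.min d d'); first by rewrite lt_min d0.
    exists (N + N')%N => n Nn vn j.
    rewrite ltnS leq_eqVlt => /predU1P[->|jK].
      apply: HN'; first by lia.
      by apply: le_trans vn; rewrite lerD2l lerN2 ge_min lexx orbT.
    apply: HN => //; first by lia.
    by apply: le_trans vn; rewrite lerD2l lerN2 ge_min lexx.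
  have [n Nn vn] := lfreq _ d0 (N + J + K)%N.
  rewrite -(renewal_sum (n - J)%N) (@big_cat_nat _ _ _ K)//=; last by lia.
  set S := series (fun j => 1 - series g j) K in HK.
  have : (l - h) * S <= \sum_(0 <= j < K) (1 - series g j) * v (n - J - j)%N.
    rewrite /S seriesEnat/= mulr_sumr; apply: ler_sum_nat => j /andP[_ jK].
    rewrite mulrC ler_wpM2l ?subr_ge0// -subnDA; apply: HN => //; lia.
  have : - h <= \sum_(K <= j < (n - J).+1) (1 - series g j) * v (n - J - j)%N.
    apply: (@le_trans _ _ (- \sum_(K <= j < (n - J).+1) (1 - series g j))).
      have := rsm (n - J).+1; rewrite seriesEnat/= (@big_cat_nat _ _ _ K)//=.
        by move: HK; rewrite /S seriesEnat/=; lra.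
      by lia.
    rewrite -sumrN; apply: ler_sum => j _; rewrite -mulrN1.
    by rewrite ler_wpM2l ?subr_ge0.
  have := rsm K; rewrite -/S; nra.
have {}lm : l * m <= v 0%N + e / 2.
  (* For this [h] the error [h * m + 2 * h] is exactly [e / 2]. *)
  have := lm (e / 2 / (m + 2)).
  have -> : l * m - e / 2 / (m + 2) * m - 2 * (e / 2 / (m + 2)) = l * m - e / 2.
    by field; have := m1; lra.
  rewrite lerBlDr; apply; rewrite divr_gt0 ?divr_gt0//; have := m1; lra.
have [|N HN] := lev (e / 2 / m).
  by rewrite !divr_gt0//; have := m1; lra.
exists N => n /HN vn.
have m0 : 0 < m by have := m1; lra.
apply: (@le_trans _ _ ((l + e / 2 / m) * m)); first by rewrite ler_pM2r.
by rewrite mulrDl divfK ?gt_eqF//; lra.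
Qed.

End upper.

(** The recursion is linear, so [renewal_upper] applies to [u] and to [- u] and bounds [u n * m]
    from both sides. *)
Lemma renewal_theorem g u (m : R) :
  (forall k, 0 <= g k) -> series g @ \oo --> (1 : R) ->
  series (fun j => 1 - series g j) @ \oo --> m ->
  (forall k, (forall j, 0 < g j -> (k %| j.+1)%N) -> k = 1%N) ->
  (forall n, `|u n| <= 1) ->
  (forall n, u n.+1 = \sum_(0 <= k < n.+1) g k * u (n - k)%N) ->
  (fun n => u n * m) @ \oo --> u 0%N.
Proof.
move=> g0 g1 gm ggcd u1 urec; apply/cvgrPdist_le => e e0.
have [N HN] := renewal_upper g0 g1 gm ggcd u1 urec e0.
have [||N' HN'] := @renewal_upper g (fun n => - u n) m g0 g1 gm ggcd _ _ e e0.
- by move=> n; rewrite normrN.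
- by move=> n; rewrite urec -sumrN; apply: eq_bigr => k _; rewrite mulrN.
exists (N + N')%N => // n /= Nn; rewrite distrC ler_norml.
have := HN n; have := HN' n.
move=> /(_ (leq_trans (leq_addl _ _) Nn)) ?.
by move=> /(_ (leq_trans (leq_addr _ _) Nn)) ?; lra.
Qed.

(** Dominated convergence: cut the sum at a fixed [K] with little mass of [g] beyond it; below [K]
    every [v (n - k)] is close to [L] once [n] is large. *)
Lemma cvg_convolution g v (F L : R) :
  (forall k, 0 <= g k) -> series g @ \oo --> F ->
  (forall n, `|v n| <= 1) -> v @ \oo --> L ->
  (fun n => \sum_(0 <= k < n.+1) g k * v (n - k)%N) @ \oo --> F * L.
Proof.
move=> g0 gF v1 vL.
have L1 : `|L| <= 1.
  by apply: (closed_cvg (fun x : R => `|x| <= 1)) vL; [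
     apply: closed_comp (@closed_le R 1) => x _; exact: norm_continuous|
     exact: nearW].
have sF n : series g n <= F.
  rewrite -(cvg_lim (@Rhausdorff R) gF); apply: nondecreasing_cvgn_le => //.
    by apply/nondecreasing_seqP => k; rewrite seriesSr lerDl.
  by apply/cvg_ex; exists F.
have F0 : 0 <= F by apply: le_trans (sF 0%N); rewrite seriesEnat/= big_geq.
apply/cvgrPdist_le => e e0.
pose h := e / (F + 3).
have h0 : 0 < h by rewrite divr_gt0// ltr_wpDl.
have hE : h * F + 3 * h = e by rewrite /h; field; lra.
clearbody h.
have [K HK] : exists K, F - series g K <= h.
  move/cvgrPdist_le : gF => /(_ _ h0)[K _ HK]; exists K.
  by apply: le_trans (ler_norm _) _; apply: HK => /=.
have [N HN] : exists N, forall n, (N <= n)%N -> `|v n - L| <= h.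
  move/cvgrPdist_le : vL => /(_ _ h0)[N _ HN]; exists N => n /HN.
  by rewrite distrC.
exists (N + K)%N => // n /= Nn.
rewrite (@big_cat_nat _ _ _ K)//=; last by lia.
have : `| \sum_(0 <= k < K) g k * v (n - k)%N - series g K * L| <= h * F.
  rewrite seriesEnat/= mulr_suml -sumrB.
  apply: (@le_trans _ _ (h * series g K)); last by rewrite ler_pM2l.
  rewrite seriesEnat/= mulr_sumr; apply: le_trans (ler_norm_sum _ _ _) _.
  apply: ler_sum_nat => k /andP[_ kK]; rewrite -mulrBr normrM ger0_norm//.
  by rewrite mulrC ler_wpM2r//; apply: HN; lia.
have : `| \sum_(K <= k < n.+1) g k * v (n - k)%N | <= h.
  apply: (@le_trans _ _ (\sum_(K <= k < n.+1) g k)).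
    apply: le_trans (ler_norm_sum _ _ _) _.
    by apply: ler_sum => k _; rewrite normrM ger0_norm// ler_piMr.
  have := sF n.+1; rewrite seriesEnat/= (@big_cat_nat _ _ _ K)//=.
    by move: HK; rewrite seriesEnat/=; lra.
  by lia.
move: L1; rewrite !ler_norml => /andP[? ?] /andP[? ?] /andP[? ?].
by have := sF K => ?; apply/andP; split; nra.
Qed.

End renewal.

(** Summation by parts turns the sum of the first [n] tails into a truncated mean plus
    [n * (1 - series g n)]. The mass from [n] on has weights [k.+1 > n] in the mean, so the whole
    stays below [M]. The limit is positive because the tail at 0 is 1. *)
Lemma cvg_series_tails (R : realType) (g : R^nat) (M : R) :
  (forall k, 0 <= g k) -> series g @ \oo --> (1 : R) ->
  (forall n, \sum_(0 <= k < n) k.+1%:R * g k <= M) ->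
  exists2 m : R, 0 < m & series (fun j => 1 - series g j) @ \oo --> m.
Proof.
move=> g0 g1 gM.
have s_nd : nondecreasing_seq (series g).
  by apply/nondecreasing_seqP => n; rewrite seriesSr lerDl.
have s1 n : series g n <= 1.
  rewrite -(cvg_lim (@Rhausdorff R) g1); apply: nondecreasing_cvgn_le => //.
  by apply/cvg_ex; exists 1.
have E n : series (fun j => 1 - series g j) n =
    n%:R * (1 - series g n) + \sum_(0 <= k < n) k.+1%:R * g k.
  elim: n => [|n IH]; first by rewrite seriesEnat/= !big_geq// mul0r addr0.
  by rewrite seriesSr IH seriesSr big_nat_recr//= -[n.+1%:R]natr1; ring.
have rM n : series (fun j => 1 - series g j) n <= M.
  rewrite E -lerBrDr.
  have : n%:R * (1 - series g n) <= M - \sum_(0 <= k < n) k.+1%:R * g k.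
    have cv : (fun K => n%:R * (series g K - series g n)) @ \oo -->
        n%:R * (1 - series g n).
      by apply: cvgMr; apply: cvgB => //; exact: cvg_cst.
    apply: (closed_cvg (fun x : R => x <= _)) cv; first exact: closed_le.
    exists n => // K /= nK; rewrite lerBrDr (le_trans _ (gM K))//.
    rewrite (@big_cat_nat _ _ _ n 0 K)//=.
    rewrite [leLHS]addrC lerD2l !seriesEnat/=.
    rewrite (@big_cat_nat _ _ _ n 0 K)//= addrAC subrr add0r mulr_sumr.
    apply: ler_sum_nat => k /andP[nk _].
    by rewrite ler_wpM2r// ler_nat ltnW.
  by [].
have r_nd : nondecreasing_seq (series (fun j => 1 - series g j)).
  by apply/nondecreasing_seqP => n; rewrite seriesSr lerDl subr_ge0.
have /cvg_ex[m gm] : cvgn (series (fun j => 1 - series g j)).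
  by apply: nondecreasing_is_cvgn => //; exists M => _ [n _ <-].
exists m => //; rewrite -(cvg_lim (@Rhausdorff R) gm).
apply: (@lt_le_trans _ _ (series (fun j => 1 - series g j) 1%N)).
  by rewrite seriesEnat /= big_nat1 seriesEnat /= big_geq// subr0.
by apply: nondecreasing_cvgn_le => //; apply/cvg_ex; exists m.
Qed.

(** * Transition matrices *)

Local Open Scope ereal_scope.

(** Finite subsums give one inequality; applied to the inverse factor, it gives the other. *)
Lemma ge0_esumZl (R : realType) (I : choiceType) (D : set I) (a : I -> \bar R)
    (c : \bar R) : c \is a fin_num -> 0 <= c -> (forall i, 0 <= a i) ->
  \esum_(i in D) (c * a i) = c * \esum_(i in D) a i.
Proof.
have le_esumZl (b : I -> \bar R) (r : R) : (0 <= r)%R -> (forall i, 0 <= b i) ->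
    \esum_(i in D) (r%:E * b i) <= r%:E * \esum_(i in D) b i.
  move=> r0 b0; apply: ge_ereal_sup => _ [X [finX XD] <-].
  rewrite -ge0_mule_fsumr// lee_wpmul2l ?lee_fin//.
  by apply: ereal_sup_ubound; exists X.
move=> /fineK <-; move: (fine c) => r; rewrite lee_fin => r0 a0.
have [->|rn0] := eqVneq r 0%R.
  by rewrite mul0e esum1// => i _; rewrite mul0e.
apply/eqP; rewrite eq_le le_esumZl//=.
have rV a' : a' = r%:E * (r^-1%:E * a').
  by rewrite muleA -EFinM divff// mul1e.
rewrite [leRHS]rV lee_wpmul2l ?lee_fin//.
have rVK a' : a' = r^-1%:E * (r%:E * a').
  by rewrite muleA -EFinM mulVf// mul1e.
rewrite (@eq_esum _ _ _ a (fun i => r^-1%:E * (r%:E * a i))); last first.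
  by move=> i _; exact: rVK.
by apply: le_esumZl => [|i]; rewrite ?invr_ge0// mule_ge0// lee_fin.
Qed.

Lemma esum_split1 (R : realType) (I : choiceType) (y : I) (a : I -> \bar R) :
  (forall i, 0 <= a i) ->
  \esum_(i in [set: I]) a i = a y + \esum_(i in [set i | i != y]) a i.
Proof.
move=> a0; rewrite (esumID [set y])// !setTI esum_set1//; congr (_ + _).
by congr esum; apply/seteqP; split => i /=; [move/eqP|move=> /eqP].
Qed.

Section transition.
Context {R : realType} {S : countType}.
Variable p : S -> S -> R.
Hypothesis hp : transition_matrix p.

Let p0 x y : 0 <= (p x y)%:E. Proof. by rewrite lee_fin; exact: hp.1. Qed.

Lemma trans_pow_ge0 n x y : 0 <= trans_pow p n x y.
Proof.
elim: n x => [|n IH] x /=; first by rewrite lee_fin.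
by apply: esum_ge0 => z _; rewrite mule_ge0.
Qed.

Lemma trans_pow_le1 n x y : trans_pow p n x y <= 1.
Proof.
elim: n x => [|n IH] x /=; first by rewrite lee_fin; case: eqP.
rewrite -(hp.2 x); apply: le_esum => z _.
by rewrite -[leRHS]mule1 lee_wpmul2l.
Qed.

Lemma trans_pow_fin n x y : trans_pow p n x y \is a fin_num.
Proof.
rewrite ge0_fin_numE ?trans_pow_ge0//.
by rewrite (le_lt_trans (trans_pow_le1 _ _ _)) ?ltry.
Qed.

Lemma first_passageSS n x y : first_passage p n.+2 x y =
  \esum_(z in [set z | z != y]) ((p x z)%:E * first_passage p n.+1 z y).
Proof. by []. Qed.

Lemma first_passage_ge0 n x y : 0 <= first_passage p n x y.
Proof.
elim: n x => [|n IH] x; first exact: lexx.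
case: n IH => [_|n IH]; first exact: p0.
by rewrite first_passageSS; apply: esum_ge0 => z _; rewrite mule_ge0.
Qed.

(* The probability that the chain started at [z] avoids [x] at times
   [1, ..., n]. *)
Fixpoint avoidance (x : S) (n : nat) (z : S) : \bar R :=
  if n is m.+1 then \esum_(w in [set w | w != x]) ((p z w)%:E * avoidance x m w)
  else 1.

Lemma avoidance_ge0 x n z : 0 <= avoidance x n z.
Proof.
elim: n z => [//|n IH] z /=.
by apply: esum_ge0 => w _; rewrite mule_ge0.
Qed.

(** Either [x] is avoided up to time [n] or some [k <= n] is the first visit. Conditioning both
    terms on the first step reduces the claim to the row sum of [p]. *)
Lemma avoidance_first_passage x n z :
  avoidance x n z + \sum_(1 <= k < n.+1) first_passage p k z x = 1.
Proof.
elim: n z => [|n IH] z; first by rewrite big_geq//= adde0.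
rewrite big_nat_recl//.
(* The index starts at 1, where [first_passage p k.+1] unfolds to its sum over the states other than
   [x]. *)
rewrite (@eq_big_nat _ _ _ _ _ _ (fun k =>
  \esum_(w in [set w | w != x]) ((p z w)%:E * first_passage p k w x)));
  last by case.
rewrite -esum_sum; last first.
  by move=> w k _ _; rewrite mule_ge0// first_passage_ge0.
rewrite addeCA -esumD; last 2 first.
- by move=> w _; rewrite mule_ge0// avoidance_ge0.
- by move=> w _; apply: sume_ge0 => k _; rewrite mule_ge0// first_passage_ge0.
rewrite -[RHS](hp.2 z) [RHS](@esum_split1 _ _ x)//; congr (_ + _).
apply: eq_esum => w _.
rewrite -ge0_sume_distrr; last by move=> k _; exact: first_passage_ge0.
rewrite -ge0_muleDr ?avoidance_ge0 ?IH ?mule1//.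
by apply: sume_ge0 => k _; exact: first_passage_ge0.
Qed.

Lemma sum_first_passage_le1 x n z :
  \sum_(1 <= k < n.+1) first_passage p k z x <= 1.
Proof. by rewrite -(avoidance_first_passage x n z) leeDr// avoidance_ge0. Qed.

Lemma first_passage_le1 n x y : first_passage p n x y <= 1.
Proof.
case: n => [|n]; first exact: lee01.
apply: le_trans (sum_first_passage_le1 y n.+1 x).
rewrite big_nat_recr//= leeDr//; apply: sume_ge0 => k _.
exact: first_passage_ge0.
Qed.

Lemma first_passage_fin n x y : first_passage p n x y \is a fin_num.
Proof.
rewrite ge0_fin_numE ?first_passage_ge0//.
by rewrite (le_lt_trans (first_passage_le1 _ _ _)) ?ltry.
Qed.

(** Decomposition at the first visit to [y]. It fails for [n = 0] and [x = y], where the sum is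
    empty; the induction meets only starting states [z != y], for which [n = 0] is allowed. *)
Lemma trans_pow_first_passage n x y : x != y \/ (0 < n)%N ->
  trans_pow p n x y = \sum_(0 <= k < n)
    first_passage p k.+1 x y * trans_pow p (n - k.+1) y y.
Proof.
elim: n x => [x [/negPf xy|//]|n IH x _]; first by rewrite big_geq//= xy.
rewrite big_nat_recl//= subSS subn0.
rewrite (@esum_split1 _ _ y); last first.
  by move=> z; rewrite mule_ge0// trans_pow_ge0.
congr (_ + _).
under eq_esum => z zy.
  rewrite IH; last by left.
  rewrite ge0_sume_distrr; last first.
    by move=> k _; rewrite mule_ge0// (trans_pow_ge0, first_passage_ge0).
  over.
rewrite esum_sum; last first.
  by move=> *; rewrite !mule_ge0// (trans_pow_ge0, first_passage_ge0).
apply: eq_bigr => k _; rewrite subSS muleC -ge0_esumZl.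
- by apply: eq_esum => z _; rewrite muleA muleC.
- exact: trans_pow_fin.
- exact: trans_pow_ge0.
- by move=> z; rewrite mule_ge0//; exact: (first_passage_ge0 k.+1).
Qed.

Hypothesis hirr : irreducible_matrix p.
Hypothesis hrec : positive_recurrent_matrix p.

(** Return from [x] to itself is certain. The property spreads along each transition of positive
    probability, as avoidance from [y] is at least [p y w] times avoidance from [w != x];
    irreducibility leads to every [z]. *)
Lemma avoidance_cvg0 x z : avoidance x n z @[n --> \oo] --> 0.
Proof.
have av_x : avoidance x n x @[n --> \oo] --> 0.
  have : (fun n => 1 - \sum_(1 <= k < n) first_passage p k x x) @ \oo --> 1 - 1.
    apply: cvgeB => //; first exact: cvg_cst.
    rewrite -[X in _ --> X](hrec x).1; apply: is_cvg_nneseries => k _ _.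
    exact: first_passage_ge0.
  rewrite subee// -cvg_shiftS; apply: cvg_trans; apply: near_eq_cvg.
  apply: nearW => n /=; rewrite -(avoidance_first_passage x n x) addeK//.
  by apply/sum_fin_numP => k _ _; exact: first_passage_fin.
suff key n y : avoidance x n y @[n --> \oo] --> 0 ->
    0 < trans_pow p n y z -> avoidance x n z @[n --> \oo] --> 0.
  by have [n] := hirr x z; exact: key.
elim: n y => [|n IH] y av_y /=.
  by rewrite lte_fin ltr0n lt0b => /eqP <-.
move=> yz; have [w wP] : exists w, 0 < (p y w)%:E * trans_pow p n w z.
  apply: contrapT => no; move: yz; rewrite esum1 ?ltxx// => w _.
  apply/eqP; rewrite eq_le mule_ge0 ?trans_pow_ge0// andbT leNgt.
  by apply/negP => h; apply: no; exists w.
have [pyw pwz] : (0 < p y w)%R /\ 0 < trans_pow p n w z.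
  rewrite !lt_def trans_pow_ge0 -lee_fin p0 !andbT.
  by split; apply: contraTneq wP => ->; rewrite ?mul0e ?mule0 ltxx.
apply: (IH w _ pwz); have [->//|wx] := eqVneq w x.
apply: (@squeeze_cvge _ _ _ _ (cst 0) _
    (fun n => ((p y w)^-1)%:E * avoidance x n.+1 y)).
- apply: nearW => k.
  rewrite avoidance_ge0//= (@esumID _ _ [set w])//; last first.
    by move=> v _; rewrite mule_ge0// avoidance_ge0.
  rewrite (_ : _ `&` [set w] = [set w]); last first.
    by apply/seteqP; split => v /=; [case|move=> ->].
  rewrite esum_set1 ?mule_ge0 ?avoidance_ge0//.
  rewrite -[leLHS]mul1e -(mulVf (lt0r_neq0 pyw)) EFinM -muleA.
  apply: lee_wpmul2l; first by rewrite lee_fin invr_ge0 hp.1.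
  rewrite leeDl//.
  by apply: esum_ge0 => v _; rewrite mule_ge0// avoidance_ge0.
- exact: cvg_cst.
- rewrite -[X in _ --> X](mule0 (((p y w)^-1)%:E)); apply: cvgeZl => //.
  by move: av_y; rewrite -cvg_shiftS.
Qed.

End transition.

(** The renewal theorem treats the passage from [y] to [y]; a start at [x] is a delay, that is, a
    convolution with the first passage law from [x] to [y], of total mass [F]. *)
Lemma trans_pow_cvg (R : realType) (S : countType) (p : S -> S -> R)
    (hp : transition_matrix p) (haper : aperiodic_matrix p)
    (hrec : positive_recurrent_matrix p) x y :
  exists L : R, (fun n => fine (trans_pow p n x y)) @ \oo --> L.
Proof.
pose g z k := fine (first_passage p k.+1 z y).
pose u z n := fine (trans_pow p n z y).
have g0 z k : (0 <= g z k)%R by rewrite fine_ge0// first_passage_ge0.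
have gE z k : (g z k)%:E = first_passage p k.+1 z y.
  by rewrite /g fineK// first_passage_fin.
have uE z n : (u z n)%:E = trans_pow p n z y.
  by rewrite /u fineK// trans_pow_fin.
have u1 z n : (`|u z n| <= 1)%R.
  by rewrite ger0_norm ?fine_ge0 ?trans_pow_ge0// -lee_fin uE trans_pow_le1.
have urec z n : u z n.+1 = (\sum_(0 <= k < n.+1) g z k * u y (n - k)%N)%R.
  apply: EFin_inj; rewrite uE trans_pow_first_passage//; last by right.
  rewrite -sumEFin; apply: eq_bigr => k _.
  by rewrite EFinM gE uE subSS.
have sE z n : (series (g z) n)%:E = \sum_(1 <= k < n.+1) first_passage p k z y.
  rewrite seriesEnat/= -sumEFin big_add1/=; apply: eq_bigr => k _.
  exact: gE.
have g1 : series (g y) @ \oo --> (1 : R)%R.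
  suff : (series (g y) n)%:E @[n --> \oo] --> 1 by move=> /fine_cvgP[].
  under eq_fun do rewrite sE.
  have : (fun n => \sum_(1 <= k < n) first_passage p k y y) @ \oo --> 1.
    rewrite -[X in _ --> X](hrec y).1; apply: is_cvg_nneseries => k _ _.
    exact: first_passage_ge0.
  by rewrite -cvg_shiftS.
have gM : exists M, forall n, (\sum_(0 <= k < n) k.+1%:R * g y k <= M)%R.
  have f0 n : 0 <= n%:R%:E * first_passage p n y y.
    by rewrite mule_ge0 ?lee_fin// first_passage_ge0.
  exists (fine (\sum_(1 <= n <oo) (n%:R%:E * first_passage p n y y))) => n.
  rewrite -lee_fin fineK; last first.
    by rewrite ge0_fin_numE ?(hrec y).2// nneseries_ge0.
  apply: le_trans (@nneseries_lim_ge _ _ xpredT 1 n.+1 _); last by [].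
  rewrite -sumEFin big_add1/= le_eqVlt; apply/orP; left; apply/eqP.
  by apply: eq_bigr => k _; rewrite EFinM gE.
have {gM}[M gM] := gM.
have [m m0 gm] := cvg_series_tails (g0 y) g1 gM.
(* Every possible return time is a sum of possible first return times, so a common divisor of the
   latter divides all return times. *)
have ggcd k : (forall j, (0 < g y j)%R -> (k %| j.+1)%N) -> k = 1%N.
  move=> kg; apply: (haper y) => n n0; rewrite -uE lte_fin.
  elim/ltn_ind: n n0 => -[//|n] IH _; rewrite urec.
  move=> u0; have [j jn gj] : exists2 j, (j < n.+1)%N &
      (0 < g y j * u y (n - j)%N)%R.
    apply: contrapT => no; move: u0; apply/negP; rewrite -leNgt.
    rewrite big_nat; apply: sumr_le0 => j /= jn; rewrite leNgt.
    by apply/negP => gj; apply: no; exists j.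
  have [gj0 uj0] : (0 < g y j)%R /\ (0 < u y (n - j)%N)%R.
    rewrite !lt_def g0 -lee_fin uE trans_pow_ge0 // !andbT.
    by split; apply: contraTneq gj => ->; rewrite ?mul0r ?mulr0 ltxx.
  have -> : n.+1 = (j.+1 + (n - j))%N by lia.
  rewrite dvdn_add ?kg//; have [->|nj0] := posnP (n - j); first exact: dvdn0.
  by apply: IH => //; lia.
have ucv := renewal_theorem (g0 y) g1 gm ggcd (u1 y) (urec y).
have [l ul] : exists l : R, u y @ \oo --> l.
  move: (u y 0%N) ucv => c ucv; exists (c / m)%R.
  rewrite (_ : u y = (fun n => u y n * m / m)%R); last first.
    by apply/funext => n; rewrite mulfK// gt_eqF.
  by apply: cvgM => //; exact: cvg_cst.
have [F gF] : exists F : R, series (g x) @ \oo --> F.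
  apply/cvg_ex; apply: nondecreasing_is_cvgn.
    by apply/nondecreasing_seqP => n; rewrite seriesSr lerDl.
  exists 1%R => _ [n _ <-].
  by rewrite -lee_fin sE sum_first_passage_le1.
exists (F * l)%R.
rewrite -cvg_shiftS.
rewrite (_ : [sequence _]_n =
    (fun n => \sum_(0 <= k < n.+1) g x k * u y (n - k)%N)%R).
  exact: cvg_convolution.
by apply/funext => n; rewrite -urec.
Qed.

(** * The Markov chain *)

(** Countable additivity over the fibres of [Z], numbered by [pickle]; numbers that code no element
    give empty sets. *)
Lemma measure_esum_fiber d (T : measurableType d) (R : realType)
    (mu : {measure set T -> \bar R}) (C : countType) (Z : T -> C)
    (mZ : forall c, measurable (Z @^-1` [set c])) (B : set T) :
  measurable B -> mu B = \esum_(c in [set: C]) mu (B `&` Z @^-1` [set c]).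
Proof.
move=> mB.
pose F n := [set w | B w /\ pickle (Z w) = n].
have Fp c : F (pickle c) = B `&` Z @^-1` [set c].
  by apply/seteqP; split => w [Bw /= wc]; split => //=;
    [exact: (pcan_inj pickleK)|rewrite wc].
have F0 n : ~ range (@pickle C) n -> F n = set0.
  by move=> Cn; apply/seteqP; split => // w [_ wn]; apply: Cn; exists (Z w).
have mF n : measurable (F n).
  have [[c _ <-]|Cn] := pselect (range (@pickle C) n).
    by rewrite Fp; exact: measurableI.
  by rewrite F0.
have -> : mu B = mu (\bigcup_n F n).
  congr (mu _); apply/seteqP; split => [w Bw|w [n _ []//]].
  by exists (pickle (Z w)).
rewrite measure_semi_bigcup//; last 2 first.
- by move=> i j _ _ [w [[_ <-] [_ <-]]].
- exact: bigcup_measurable.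
rewrite nneseries_esumT//.
transitivity (\esum_(n in range (@pickle C)) mu (F n)).
  rewrite [RHS]esum_mkcond; apply: eq_esum => n _.
  case: ifPn => // /negP; rewrite inE => /F0 ->; exact: measure0.
rewrite esum_image; last by move=> a b _ _; exact: (pcan_inj pickleK).
by apply: eq_esum => c _; rewrite Fp.
Qed.

Section markov.
Context {R : realType} {S : countType}.
Variable p : S -> S -> R.
Hypothesis hp : transition_matrix p.
Context d {T : measurableType d}.
Variables (P : probability T R) (X : int -> T -> S).
Hypothesis hX : markov_chain P p X.

Let p0 x y : 0 <= (p x y)%:E. Proof. by rewrite lee_fin; exact: hp.1. Qed.

Let mX t (B : set S) : measurable (X t @^-1` B). Proof. exact: hX.1. Qed.

Let finP A : measurable A -> P A \is a fin_num.
Proof. exact: fin_num_measure. Qed.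

Lemma past_measurable t A : past X t A -> measurable A.
Proof.
apply: smallest_sub; first exact: sigma_algebra_measurable.
by move=> _ [s _ [B _ <-]].
Qed.

Lemma past_le s t : (s <= t)%R -> past X s `<=` past X t.
Proof.
move=> st; apply: sub_sigma_algebra2 => _ [r rs [B _ <-]].
by exists r; [exact: le_trans st|exists B].
Qed.

Lemma past_preimage s t (B : set S) : (s <= t)%R -> past X t (X s @^-1` B).
Proof.
by move=> st; apply: sub_sigma_algebra; exists s => //; exists B.
Qed.

Lemma pastI t A B : past X t A -> past X t B -> past X t (A `&` B).
Proof. exact: (@measurableI _ (g_sigma_algebraType _)). Qed.

Lemma pastC t A : past X t A -> past X t (~` A).
Proof. exact: (@measurableC _ (g_sigma_algebraType _)). Qed.

Lemma pastU t A B : past X t A -> past X t B -> past X t (A `|` B).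
Proof. exact: (@measurableU _ (g_sigma_algebraType _)). Qed.

Lemma past_set0 t : past X t set0.
Proof. exact: sigma_algebra0. Qed.

Lemma pastT t : past X t setT.
Proof. exact: (@measurableT _ (g_sigma_algebraType _)). Qed.

(** The given version of the conditional probability is constant on the event [X t = z], so its
    integral is a product. *)
Lemma markov_step t A z y : past X t A ->
  P (A `&` X t @^-1` [set z] `&` X (t + 1) @^-1` [set y]) =
  P (A `&` X t @^-1` [set z]) * (p z y)%:E.
Proof.
move=> pA; have pAz : past X t (A `&` X t @^-1` [set z]).
  by apply: pastI => //; exact: past_preimage.
have [_ _ <-//] := hX.2 t y.
rewrite (@eq_integral _ _ _ _ _ (cst (p z y)%:E)).
  by rewrite integral_cst; [rewrite muleC|exact: past_measurable pAz].
by move=> w; rewrite inE => -[_ /= ->].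
Qed.

(** Split by the state at [t + 1]. The past event [A] is arbitrary so that the induction can absorb
    [X t = z] into it. *)
Lemma markov_steps n t A z y : past X t A ->
  P (A `&` X t @^-1` [set z] `&` X (t + n%:Z) @^-1` [set y]) =
  P (A `&` X t @^-1` [set z]) * trans_pow p n z y.
Proof.
elim: n t A z => [|n IH] t A z pA.
  rewrite addr0/=; have [->|zy] := eqVneq z y.
    by rewrite mule1 -setIA setIid.
  rewrite mule0 (_ : _ `&` _ = set0) ?measure0//.
  by apply/seteqP; split => // w [[_ /= ->]] /eqP; rewrite (negPf zy).
have mA := past_measurable pA.
rewrite (@measure_esum_fiber _ _ _ _ _ (X (t + 1))); last 2 first.
- by move=> c; exact: mX.
- by apply: measurableI => //; exact: measurableI.
rewrite /= -ge0_esumZl; last 3 first.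
- by apply: finP; exact: measurableI.
- exact: measure_ge0.
- by move=> w; rewrite mule_ge0// trans_pow_ge0.
apply: eq_esum => w _; rewrite muleA -markov_step// -IH.
  by rewrite setIAC (_ : t + n.+1%:Z = t + 1 + n%:Z)%R//; lia.
apply: pastI; last by apply: past_preimage; lia.
by apply: past_le pA; lia.
Qed.

(** The times are [t + 1] to [t + n]: as in [avoidance], the state at time [t] itself is free. *)
Definition avoids (x : S) (t : int) n : set T :=
  \bigcap_(i in [set i | (i < n)%N]) ~` (X (t + i.+1%:Z) @^-1` [set x]).

Lemma measurable_avoids x t n : measurable (avoids x t n).
Proof.
apply: bigcap_measurableType => i _; exact: measurableC.
Qed.

Lemma markov_avoids x n t A z : past X t A ->
  P (A `&` X t @^-1` [set z] `&` avoids x t n) =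
  P (A `&` X t @^-1` [set z]) * avoidance p x n z.
Proof.
elim: n t A z => [|n IH] t A z pA.
  rewrite /avoids (_ : [set i | _] = set0) ?bigcap_set0 ?setIT ?mule1//.
  by apply/seteqP; split.
have mA := past_measurable pA.
rewrite (@measure_esum_fiber _ _ _ _ _ (X (t + 1))); last 2 first.
- by move=> c; exact: mX.
- apply: measurableI; last exact: measurable_avoids.
  exact: measurableI.
rewrite /= -ge0_esumZl; last 3 first.
- by apply: finP; exact: measurableI.
- exact: measure_ge0.
- by move=> w; rewrite mule_ge0// avoidance_ge0.
rewrite [RHS]esum_mkcond; apply: eq_esum => w _.
(* The fibre over [x] is empty, which matches its absence from the sum in [avoidance]. *)
have [wx|wx] := eqVneq w x.
  rewrite memNset/= ?wx ?eqxx// (_ : _ `&` _ = set0) ?measure0//.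
  by apply/seteqP; split => // v [[_ av] vw]; apply: (av 0%N) => //=.
rewrite mem_set//.
rewrite muleA -markov_step// -IH; last first.
  apply: pastI; last by apply: past_preimage; lia.
  by apply: past_le pA; lia.
congr (P _); apply/seteqP; split => v /=.
  move=> [[[Av vz] av] vw]; split => // i /= ni.
  have := av i.+1 ni; rewrite /=.
  by rewrite (_ : t + i.+2%:Z = t + 1 + i.+1%:Z)%R//; lia.
move=> [[[Av vz] vw] av]; split => //; split => // -[|i] /= ni.
  by rewrite vw; exact/eqP.
have := av i ni; rewrite /=.
by rewrite (_ : t + i.+2%:Z = t + 1 + i.+1%:Z)%R//; lia.
Qed.

(** * Recurrence, and bi-recurrence of stationary chains *)

Hypothesis hirr : irreducible_matrix p.
Hypothesis hrec : positive_recurrent_matrix p.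

(** On each event [X t = z] the probability is below that of avoiding [x] for [n] steps, which tends
    to 0; there are countably many [z]. *)
Lemma avoids_forever_null x t : P (\bigcap_n avoids x t n) = 0.
Proof.
have mN : measurable (\bigcap_n avoids x t n).
  by apply: bigcapT_measurable => n; exact: measurable_avoids.
rewrite (@measure_esum_fiber _ _ _ _ _ (X t))//.
apply: esum1 => z _; apply/eqP; rewrite eq_le measure_ge0 andbT.
have cv : P (X t @^-1` [set z]) * avoidance p x n z @[n --> \oo] --> 0.
  rewrite -[X in _ --> X](mule0 (P (X t @^-1` [set z]))).
  by apply: cvgeZl; [exact: finP|exact: avoidance_cvg0].
apply: (closed_cvg (fun x => _ <= x)) cv; first exact: closed_ereal_le_ereal.
apply: nearW => n; rewrite -[X in P X * _]setTI.
rewrite -markov_avoids; last exact: pastT.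
apply: le_measure; rewrite ?inE.
- exact: measurableI.
- by rewrite setTI; apply: measurableI => //; exact: measurable_avoids.
- by move=> v [av vz]; split => //; exact: av.
Qed.

Lemma recurrent_forward x :
  {ae P, forall w, forall n : int, exists2 t : int, (n <= t)%R & X t w = x}.
Proof.
have fwd : {ae P, forall w, forall n : nat,
    exists2 t : int, (n%:Z <= t)%R & X t w = x}.
  apply: ae_foralln => n; exists (\bigcap_m avoids x n m); split.
  - by apply: bigcapT_measurable => m; exact: measurable_avoids.
  - exact: avoids_forever_null.
  - move=> w /= nw m _ i /= im Xx; apply: nw; exists (n%:Z + i.+1%:Z)%R => //.
    by lia.
apply: filterS fwd => w fwd n; have [t nt tx] := fwd `|n|%N.
by exists t => //; lia.
Qed.

Lemma stationary_bi_recurrent x : stationary P X -> bi_recurrent P X x.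
Proof.
move=> st.
pose B m := [set u : int -> S | forall j, (j < m)%N -> u j.+1%:Z <> x].
have pB m : path_measurable (B m).
  pose G j := if (j < m)%N then [set u : int -> S | [set x] (u j.+1%:Z)]
    else set0.
  have -> : B m = setT `\` \bigcup_j G j.
    apply/seteqP; split => u /= Bu.
      split => // -[j _]; rewrite /G; case: ifPn => // jm /=; exact: Bu.
    by case: Bu => _ nG j jm uj; apply: nG; exists j => //; rewrite /G jm.
  apply: sigma_algebraCD; apply: sigma_algebra_bigcup => j.
  rewrite /G; case: ifPn => _; last exact: sigma_algebra0.
  by apply: sub_sigma_algebra; exists j.+1%:Z => //; exists [set x].
have avE m : avoids x 0%R m = [set w | B m (fun t => X t w)].
  by apply/seteqP; split => w av j jm; have := av j jm; rewrite /= add0r.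
have bwd t : P (\bigcap_i ~` (X (t - i%:Z)%R @^-1` [set x])) = 0.
  apply/eqP; rewrite eq_le measure_ge0 andbT.
  have cv : P (avoids x 0%R n) @[n --> \oo] --> 0.
    rewrite -(avoids_forever_null x 0%R); apply: nonincreasing_cvg_mu.
    - by rewrite -ge0_fin_numE// finP//; exact: measurable_avoids.
    - by move=> n; exact: measurable_avoids.
    - by apply: bigcapT_measurable => n; exact: measurable_avoids.
    - move=> m n mn; apply/subsetPset => w av i /= im; apply: av => /=.
      exact: leq_trans im mn.
  apply: (closed_cvg (fun x => _ <= x)) cv; first exact: closed_ereal_le_ereal.
  (* Avoiding [x] at all times up to [t] includes avoiding it on the [m] times ending at [t], a
     shift of the window from 1 to [m]. *)
  apply: nearW => m; rewrite avE -(st (t - m%:Z)%R _ (pB m)).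
  apply: le_measure; rewrite ?inE.
  - by apply: bigcapT_measurable => i; exact: measurableC.
  - rewrite (_ : [set w | _] = avoids x (t - m%:Z)%R m).
      exact: measurable_avoids.
    by apply/seteqP; split => w av j jm; have := av j jm; rewrite /= addrC.
  - move=> w av j jm; have := av (m - j.+1)%N I; rewrite /=.
    by rewrite (_ : t - (m - j.+1)%N%:Z = j.+1%:Z + (t - m%:Z))%R//; lia.
have bwd' : {ae P, forall w, forall n : nat,
    exists2 t : int, (t <= - n%:Z)%R & X t w = x}.
  apply: ae_foralln => n.
  exists (\bigcap_i ~` (X (- n%:Z - i%:Z)%R @^-1` [set x])); split.
  - by apply: bigcapT_measurable => i; exact: measurableC.
  - exact: bwd.
  - move=> w /= nw i _ /= Xx; apply: nw; exists (- n%:Z - i%:Z)%R => //.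
    by lia.
apply: filterS2 (recurrent_forward x) bwd' => w fw bw; split=> // n.
by have [t nt tx] := bw `|n|%N; exists t => //; lia.
Qed.

(** * First visits and the marginal laws of a bi-recurrent chain *)

Definition visits (x : S) (a : int) n :=
  [set w | exists2 i, (i < n)%N & X (a + i%:Z)%R w = x].

(** The added piece is the event that the first visit to [x] from time [a] on happens at time
    [a + n]. *)
Lemma visitsS (x : S) (a : int) n : visits x a n.+1 =
  visits x a n `|` (~` visits x a n `&` X (a + n%:Z)%R @^-1` [set x]).
Proof.
apply/seteqP; split => w.
  have [vn|nv] := pselect (visits x a n w); first by left.
  move=> [i + Xi]; rewrite ltnS leq_eqVlt => /predU1P[in_|ilt].
    by right; split => //=; rewrite -in_.
  by left; exists i.
move=> [[i ilt Xi]|[_ Xn]]; first by exists i => //; exact: ltnW.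
by exists n.
Qed.

Lemma past_visits (x : S) (a : int) n : past X (a + n%:Z)%R (visits x a n).
Proof.
elim: n => [|n IH].
  rewrite (_ : visits x a 0 = set0); first exact: past_set0.
  by apply/seteqP; split => // w [].
have {}IH : past X (a + n.+1%:Z)%R (visits x a n) by apply: past_le IH; lia.
rewrite visitsS; apply: pastU => //; apply: pastI; first exact: pastC.
by apply: past_preimage; lia.
Qed.

Lemma measurable_visits (x : S) (a : int) n : measurable (visits x a n).
Proof. exact: past_measurable (@past_visits x a n). Qed.

(* Splitting according to the first visit to [x], from which [t] is at least
   [n0] steps away. *)
Lemma visits_approx (x y : S) (L e : R) (n0 : nat) (t : int) :
  (forall n, (n0 <= n)%N -> `|fine (trans_pow p n x y) - L| <= e)%R ->
  forall (n : nat) (a : int), (a + n%:Z + n0%:Z <= t)%R ->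
  (`|fine (P (visits x a n `&` X t @^-1` [set y])) -
     L * fine (P (visits x a n))| <= e * fine (P (visits x a n)))%R.
Proof.
move=> hL n a; elim: n => [_|n IH ant].
  rewrite (_ : visits x a 0 = set0).
    by rewrite set0I measure0/= !mulr0 subr0 normr0.
  by apply/seteqP; split => // w [].
have {}IH := IH ltac:(lia).
set V := visits x a n in IH *; pose A := ~` V `&` X (a + n%:Z)%R @^-1` [set x].
have mV : measurable V by exact: measurable_visits.
have mA : measurable A by apply: measurableI => //; exact: measurableC.
have VA : V `&` A = set0 by apply/seteqP; split => // w [Vw []].
have [k tE] : exists k : nat, t = (a + n%:Z + (n0 + k)%N%:Z)%R.
  by exists `|(t - (a + n%:Z + n0%:Z))%R|%N; lia.
have -> : P (visits x a n.+1) = P V + P A by rewrite visitsS measureU.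
(* On [A] the chain is at [x] at time [a + n], and [A] constrains nothing later, so [n0 + k] free
   steps lead to time [t]. *)
have -> : P (visits x a n.+1 `&` X t @^-1` [set y]) =
    P (V `&` X t @^-1` [set y]) + P A * trans_pow p (n0 + k) x y.
  rewrite visitsS -/V -/A setIUl tE -markov_steps -?tE; last first.
    by apply: pastC; exact: past_visits.
  apply: measureU; [exact: measurableI|exact: measurableI|].
  by rewrite setIACA VA set0I.
rewrite !fineD ?finP//; last 2 first.
- exact: measurableI.
- by apply: fin_numM; rewrite ?finP// trans_pow_fin.
rewrite fineM ?trans_pow_fin ?finP//.
have := hL (n0 + k)%N (leq_addr _ _).
have : (0 <= fine (P A))%R by rewrite fine_ge0.
move: IH; set a1 := fine (P V); set a2 := fine (P A).
set b := fine (P (_ `&` _)).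
rewrite !ler_norml => /andP[? ?] ? /andP[? ?]; apply/andP; split; nra.
Qed.

Hypothesis haper : aperiodic_matrix p.

(** The common value is the limit [L] of [p^n(x, y)]. A visit to [x] at least [n0] steps before [t]
    is almost certain within a long enough window, and given such a visit [visits_approx]
    applies. *)
Lemma bi_recurrent_marginal x y : bi_recurrent P X x ->
  exists l : \bar R, forall t, P (X t @^-1` [set y]) = l.
Proof.
move=> bi; have [L cvL] := trans_pow_cvg hp haper hrec x y.
exists L%:E => t; rewrite -[LHS]fineK ?finP//; congr EFin.
apply/eqP; rewrite -subr_eq0 -normr_le0; apply/ler_addgt0Pl => e e0.
rewrite addr0.
(* Three errors occur: [h] on the visit event [V k], [h] off it, and [|L| * h] from replacing its
   probability by 1. *)
pose h := (e / (2 + `|L|))%R.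
have L0 : (0 < 2 + `|L|)%R by rewrite ltr_wpDr.
have h0 : (0 < h)%R by rewrite divr_gt0.
have hE : (h * (2 + `|L|) = e)%R by rewrite /h divfK// gt_eqF.
clearbody h.
have [n0 hL] : exists n0, forall n, (n0 <= n)%N ->
    (`|fine (trans_pow p n x y) - L| <= h)%R.
  move/cvgrPdist_le : cvL => /(_ _ h0)[n0 _ H]; exists n0 => n /H.
  by rewrite distrC.
pose V k := visits x (t - n0%:Z - k%:Z)%R k.
have mV k : measurable (V k) by exact: measurable_visits.
have PV : P (\bigcup_k V k) = 1.
  have mU : measurable (\bigcup_k V k) by exact: bigcup_measurable.
  suff : P (~` \bigcup_k V k) = 0.
    by rewrite probability_setC// => /eqP; rewrite sube_eq ?add0e// => /eqP ->.
  apply: measure_negligible; first exact: measurableC.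
  apply: negligibleS bi => w /= nV bi; apply: nV.
  have [s st sx] := bi.2 (t - n0%:Z - 1)%R.
  (* With this length the window starts exactly at the visit time [s]. *)
  pose k := `|(t - n0%:Z - s)%R|%N.
  exists k => //; exists 0%N; first by rewrite /k; lia.
  by rewrite (_ : _ + _ = s)%R// /k; lia.
have cv : P (V k) @[k --> \oo] --> 1.
  rewrite -PV; apply: nondecreasing_cvg_mu => //.
    exact: bigcup_measurable.
  move=> m n mn; apply/subsetPset => w [i im Xi].
  exists (i + (n - m))%N; first by lia.
  by rewrite -Xi; congr (X _ w); lia.
have [k Vk] : exists k, (1 - h <= fine (P (V k)))%R.
  have /fine_cvgP[_ /cvgrPdist_le/(_ _ h0)[k _ H]] := cv.
  exists k; have := H k (leqnn _).
  by rewrite /= ler_norml => /andP[_]; lra.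
have := visits_approx hL (_ : (t - n0%:Z - k%:Z + k%:Z + n0%:Z <= t)%R).
rewrite -/(V k) => /(_ ltac:(lia)).
have V1 : (fine (P (V k)) <= 1)%R.
  by rewrite -lee_fin fineK ?finP// probability_le1.
have : P (X t @^-1` [set y]) = P (V k `&` X t @^-1` [set y]) +
    P (~` V k `&` X t @^-1` [set y]).
  rewrite -measureU//; last 3 first.
  - exact: measurableI.
  - by apply: measurableI => //; exact: measurableC.
  - by rewrite setIACA setICr set0I.
  by rewrite -setIUl setUv setTI.
move=> ->; rewrite fineD ?finP//; last 2 first.
- exact: measurableI.
- by apply: measurableI => //; exact: measurableC.
have : (fine (P (~` V k `&` X t @^-1` [set y])) <= h)%R.
  apply: (@le_trans _ _ (fine (P (~` V k)))).
    apply: fine_le; rewrite ?finP//; try exact: measurableC.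
      by apply: measurableI => //; exact: measurableC.
    apply: le_measure; rewrite ?inE; last exact: subIsetl.
      by apply: measurableI => //; exact: measurableC.
    exact: measurableC.
  by rewrite probability_setC// fineB ?finP//=; lra.
have : (0 <= fine (P (~` V k `&` X t @^-1` [set y])))%R by rewrite fine_ge0.
have : (`|L * (1 - fine (P (V k)))| <= `|L| * h)%R.
  by rewrite normrM ler_wpM2l// ger0_norm; lra.
have : (h * fine (P (V k)) <= h)%R by rewrite ler_piMr// ltW.
rewrite !ler_norml => ? /andP[? ?] ? ? /andP[? ?]; apply/andP; split; lra.
Qed.

(** * Laws of finite windows and stationarity *)

Definition window_eq (t : int) (n : nat) (c : nat -> S) : set T :=
  \bigcap_(i in [set i | (i < n)%N]) (X (t + i%:Z) @^-1` [set c i]).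

Lemma window_eqS t n c : window_eq t n.+1 c =
  window_eq t n c `&` X (t + n%:Z) @^-1` [set c n].
Proof.
apply/seteqP; split => w.
  by move=> W; split => [i /= ilt|]; apply: W => //=; exact: ltnW.
move=> [W Xn] i /=; rewrite ltnS leq_eqVlt => /predU1P[->//|]; exact: W.
Qed.

Lemma past_window_eq t n c : past X (t + n%:Z) (window_eq t n c).
Proof.
elim: n => [|n IH].
  rewrite (_ : window_eq t 0 c = setT); first exact: pastT.
  by apply/seteqP; split.
rewrite window_eqS; apply: pastI; last by apply: past_preimage; lia.
by apply: past_le IH; lia.
Qed.

Hypothesis marginal : forall y, exists l : \bar R,
  forall t, P (X t @^-1` [set y]) = l.

(** A window of length one has the marginal law, and each further state contributes a transition
    probability that does not involve the time. *)
Lemma window_eq_shift s t n c : P (window_eq s n c) = P (window_eq t n c).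
Proof.
case: n => [|n].
  by congr (P _); apply/seteqP; split.
elim: n => [|n IH].
  have [l ml] := marginal (c 0%N).
  have E r : window_eq r 1 c = X r @^-1` [set c 0%N].
    apply/seteqP; split => w; first by move/(_ 0%N isT); rewrite /= addr0.
    by move=> Xr [|//] _; rewrite /= addr0.
  by rewrite !E !ml.
have E r : P (window_eq r n.+2 c) =
    P (window_eq r n.+1 c) * (p (c n) (c n.+1))%:E.
  rewrite [in RHS]window_eqS -markov_step; last exact: past_window_eq.
  by rewrite 2!window_eqS (_ : r + n.+1%:Z = r + n%:Z + 1)%R//; lia.
by rewrite !E IH.
Qed.

(** As a sequence, the window takes values in a countable type, so that the preimage of any set of
    values is a countable union of events [window_eq]. *)
Definition window (t : int) (n : nat) (w : T) : seq S :=
  [seq X (t + i%:Z)%R w | i <- iota 0 n].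

Lemma size_window t n w : size (window t n w) = n.
Proof. by rewrite size_map size_iota. Qed.

Lemma nth_window x0 t n w i : (i < n)%N ->
  nth x0 (window t n w) i = X (t + i%:Z)%R w.
Proof. by move=> ilt; rewrite (nth_map 0%N) ?size_iota// nth_iota. Qed.

Lemma window_preimage1 x0 t n s : window t n @^-1` [set s] =
  if size s == n then window_eq t n (nth x0 s) else set0.
Proof.
apply/seteqP; split => w.
  by move=> /= <-; rewrite size_window eqxx => i /= ilt; rewrite nth_window.
case: ifPn => // /eqP sn W; apply: (@eq_from_nth _ x0).
  by rewrite size_window.
by move=> i; rewrite size_window => ilt; rewrite nth_window//; exact: W.
Qed.

Lemma measurable_window t n (D : set (seq S)) : measurable (window t n @^-1` D).
Proof.
rewrite (_ : _ @^-1` D = \bigcup_(s : seq S)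
    if s \in D then window t n @^-1` [set s] else set0).
  apply: countable_bigcupT_measurable => [|s]; first exact: countableP.
  (* [T] is pointed, so [S] has an element to serve as default for [nth]. *)
  case: ifPn => // _; rewrite (window_preimage1 (X 0%R point)).
  case: ifPn => // _; exact: past_measurable (@past_window_eq _ _ _).
apply/seteqP; split => w /= => [Dw|[s _]].
  by exists (window t n w) => //; rewrite mem_set.
by case: ifPn => // /set_mem Ds /= ->.
Qed.

Lemma window_law (s t : int) n (D : set (seq S)) :
  P (window s n @^-1` D) = P (window t n @^-1` D).
Proof.
have E r : P (window r n @^-1` D) =
    \esum_(c in D) P (window r n @^-1` [set c]).
  rewrite (@measure_esum_fiber _ _ _ _ _ (window r n)); last 2 first.
  - by move=> c; exact: measurable_window.
  - exact: measurable_window.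
  rewrite [RHS]esum_mkcond; apply: eq_esum => c _.
  case: (boolP (c \in D)) => [/set_mem Dc|/negP Dc].
    congr (P _); apply/seteqP; split => w /=; first by case.
    by move=> wc; split => //; rewrite wc.
  rewrite (_ : _ `&` _ = set0) ?measure0//.
  by apply/seteqP; split => // w /= [+ wc]; rewrite wc => /mem_set.
rewrite !E; apply: eq_esum => c _.
rewrite !(@window_preimage1 (X 0%R point)); case: ifP => // _.
exact: window_eq_shift.
Qed.

(** Dynkin's argument: the sets whose probability is unchanged by the shift [h] form a
    lambda-system, and it contains the cylinders, which are stable under intersection and generate
    every measurable set of paths. *)
Lemma marginal_stationary : stationary P X.
Proof.
pose x0 := X 0%R point.
move=> h.
pose cylinder := [set B : set (int -> S) | exists n : nat,
  forall u v, (forall t : int, (`|t| <= n)%N -> u t = v t) -> B u -> B v].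
pose H := [set B : set (int -> S) |
  [/\ measurable [set w | B (fun t => X (t + h)%R w)],
      measurable [set w | B (fun t => X t w)] &
      P [set w | B (fun t => X (t + h)%R w)] = P [set w | B (fun t => X t w)]]].
have HC : setC_closed H.
  move=> B [mB mB' BB']; split; [exact: measurableC|exact: measurableC|].
  have := probability_setC P mB; have := probability_setC P mB'.
  by rewrite /setC /= BB' => -> ->.
have HU : forall F : (set (int -> S))^nat, trivIset setT F ->
    (forall n, H (F n)) -> H (\bigcup_n F n).
  move=> F tF HF.
  have E (f : T -> int -> S) : [set w | (\bigcup_n F n) (f w)] =
      \bigcup_n [set w | F n (f w)] by [].
  have tE (f : T -> int -> S) : trivIset setT (fun n => [set w | F n (f w)]).
    by move=> i j _ _ [w [Fi Fj]]; apply: tF => //; exists (f w).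
  split.
  - by rewrite E; apply: bigcup_measurable => n _; case: (HF n).
  - by rewrite E; apply: bigcup_measurable => n _; case: (HF n).
  - rewrite !E !measure_semi_bigcup//.
    + by apply: eq_eseriesr => n _; case: (HF n).
    + by move=> n; case: (HF n).
    + by apply: bigcup_measurable => n _; case: (HF n).
    + by move=> n; case: (HF n).
    + by apply: bigcup_measurable => n _; case: (HF n).
have cylI : setI_closed cylinder.
  move=> A B [m Am] [n Bn]; exists (maxn m n) => u v uv [Au Bu]; split.
    by apply: Am Au => t tm; apply: uv; rewrite leq_max tm.
  by apply: Bn Bu => t tn; apply: uv; rewrite leq_max tn orbT.
have cylH : cylinder `<=` H.
  move=> B [n Bn].
  (* Coordinate [t] between [-n] and [n] sits at position [t + n]; what is read at other times does
     not affect [B]. *)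
  pose D := [set s : seq S | B (fun t => nth x0 s `|(t + n%:Z)%R|%N)].
  have E k : [set w | B (fun t => X (t + k)%R w)] =
      window (k - n%:Z)%R (n + n).+1 @^-1` D.
    have nthE w t : (`|t| <= n)%N ->
        nth x0 (window (k - n%:Z)%R (n + n).+1 w) `|(t + n%:Z)%R|%N =
        X (t + k)%R w.
      move=> tn; rewrite nth_window; last by lia.
      by congr (X _ w); lia.
    apply/seteqP; split => w; apply: Bn => t tn; first by rewrite nthE.
    by rewrite nthE.
  have E0 : [set w | B (fun t => X t w)] = [set w | B (fun t => X (t + 0)%R w)].
    by under [in RHS]eq_set do under eq_fun do rewrite addr0.
  split; rewrite ?E0 !E; [exact: measurable_window..|exact: window_law].
move=> B pB.
suff : path_measurable `<=` H by move=> /(_ B pB)[].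
apply: (@subset_trans _ (<<s cylinder >>)).
  apply: sub_sigma_algebra2 => _ [t _ [D _ <-]].
  by exists `|t|%N => u v uv /=; rewrite uv.
apply: lambda_system_subset => //.
apply/dynkin_lambda_system; split => //.
by split; rewrite ?probability_setT//; exact: measurableT.
Qed.

End markov.

Theorem theorem4p10 (R : realType) (S : countType) (p : S -> S -> R)
    (hp : transition_matrix p) (hirr : irreducible_matrix p)
    (haper : aperiodic_matrix p) (hrec : positive_recurrent_matrix p)
    (d : measure_display) (T : measurableType d) (P : probability T R)
    (X : int -> T -> S) (hX : markov_chain P p X) :
  (stationary P X <-> exists x : S, bi_recurrent P X x) /\
  (stationary P X <-> forall x : S, bi_recurrent P X x).
Proof.
have ac x : stationary P X -> bi_recurrent P X x.
  exact: (stationary_bi_recurrent hp hX hirr hrec).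
have ba : (exists x : S, bi_recurrent P X x) -> stationary P X.
  move=> [x bi]; apply: (marginal_stationary hX) => y.
  exact: (bi_recurrent_marginal hp hX hrec haper y bi).
(* A state must exist for the passage from every [x] to some [x]; the point of [T] provides one. *)
have x0 : S := X 0%R point.
by split; split => [st|bi];
  [exists x0; exact: ac|exact: ba|move=> x; exact: ac|apply: ba; exists x0].
Qed.
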